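(* Let $f(z)=e^z$ and let $U\subset\mathbb{C}$ be open and nonempty. Then $U$ contains a repelling periodic point of $f$.
   Context: A point $p$ is periodic if $f^n(p)=p$ for some $n\geq1$ ($f^n$ the $n$-th iterate); it is repelling if moreover $|(f^n)'(p)|>1$. *)

(* Defs.v *)
From Stdlib Require Import Reals.
Open Scope R_scope.

Definition Cplx : Type := (R * R)%type.

Definition Cadd (z w : Cplx) : Cplx := (fst z + fst w, snd z + snd w).
Definition Csub (z w : Cplx) : Cplx := (fst z - fst w, snd z - snd w).
Definition Cmul (z w : Cplx) : Cplx :=
  (fst z * fst w - snd z * snd w, fst z * snd w + snd z * fst w).
Definition Cmod (z : Cplx) : R := sqrt (fst z ^ 2 + snd z ^ 2).

Definition Cexp (z : Cplx) : Cplx := (exp (fst z) * cos (snd z), exp (fst z) * sin (snd z)).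

Fixpoint iter (n : nat) (f : Cplx -> Cplx) (z : Cplx) : Cplx :=
  match n with
  | O => z
  | S m => f (iter m f z)
  end.

Definition has_cderiv (g : Cplx -> Cplx) (p L : Cplx) : Prop :=
  forall eps : R, eps > 0 -> exists delta : R, delta > 0 /\
    forall h : Cplx, 0 < Cmod h -> Cmod h < delta ->
      Cmod (Csub (Csub (g (Cadd p h)) (g p)) (Cmul L h)) <= eps * Cmod h.

Definition periodic_point (f : Cplx -> Cplx) (p : Cplx) : Prop :=
  exists n : nat, (1 <= n)%nat /\ iter n f p = p.

Definition repelling_periodic_point (f : Cplx -> Cplx) (p : Cplx) : Prop :=
  exists n : nat, (1 <= n)%nat /\ iter n f p = p /\
    exists L : Cplx, has_cderiv (iter n f) p L /\ Cmod L > 1.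

Definition C_open (U : Cplx -> Prop) : Prop :=
  forall z, U z -> exists r : R, r > 0 /\ forall w, Cmod (Csub w z) < r -> U w.

(* Main.v *)
(** Let [f = Cexp]. First, preimages of the real axis are dense: [f] expands the
    hyperbolic metric of the upper and lower half planes, strictly at points with
    imaginary part bounded away from 0, and an orbit avoiding the real axis visits
    such points infinitely often. Pulling back, along the orbit of [z], a short
    hyperbolic step to a point with imaginary part in [PI * Z] therefore yields
    points arbitrarily close to [z] whose orbit meets the real axis.

    Second, a point [z <> 0] whose orbit meets the real axis escapes to [+oo]
    along it, so inverse branches of high iterates map a disc of radius 10 around a
    huge real [X] into a tiny neighbourhood of [z]. That disc contains a second
    preimage [Log (log z + 2 k PI i)] of [z] with [2 k PI ~ exp X]. Composing, some
    inverse branch of an iterate contracts a disc around [z] into itself; its fixed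
    point is a repelling periodic point. *)

Require Import Defs.
From Stdlib Require Import Reals Lra Lia Classical ClassicalEpsilon.
From Coquelicot Require Import Coquelicot.
Open Scope R_scope.

(** * Trigonometric inequalities and expansion of [Cexp] *)

Lemma le_of_derive_nonneg (g dg : R -> R) (a b : R) :
  a <= b ->
  (forall x, a <= x <= b -> is_derive g x (dg x)) ->
  (forall x, a <= x <= b -> 0 <= dg x) ->
  g a <= g b.
Proof.
  intros Hab Hd Hp.
  destruct (MVT_gen g a b dg) as [c [Hc E]];
    rewrite ?Rmin_left, ?Rmax_right in * by lra.
  - intros x Hx; apply Hd; lra.
  - intros x Hx; apply continuity_pt_filterlim.
    apply (ex_derive_continuous (V := R_NormedModule)).
    exists (dg x); apply Hd; lra.
  - pose proof (Hp c Hc); nra.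
Qed.

Lemma mul_cos_le_sin (x : R) : 0 <= x <= PI -> x * cos x <= sin x.
Proof.
  intros Hx.
  assert (H : sin 0 - 0 * cos 0 <= sin x - x * cos x).
  { apply (le_of_derive_nonneg (fun x => sin x - x * cos x) (fun x => x * sin x)).
    - lra.
    - intros t _; auto_derive; [easy | ring].
    - intros t Ht; pose proof (sin_ge_0 t ltac:(lra) ltac:(lra)); nra. }
  rewrite sin_0 in H; lra.
Qed.

Lemma sin_le_self (x : R) : 0 <= x -> sin x <= x.
Proof.
  intros [Hx | <-]; [left; now apply sin_lt_x | rewrite sin_0; lra].
Qed.

(** Equivalent on (0, PI) to [cot x - 1 / x <= - x / 3], a bound on the logarithmic derivative of
    [sin x / x]. The difference of the two sides has derivative [x / 3 * (sin x - x * cos x)],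
    nonnegative by the preceding inequality. *)
Lemma mul_cos_quadratic_le_sin (x : R) :
  0 <= x <= PI -> x * cos x + x ^ 2 * sin x / 3 <= sin x.
Proof.
  intros Hx.
  assert (H : sin 0 - 0 * cos 0 - 0 ^ 2 * sin 0 / 3
              <= sin x - x * cos x - x ^ 2 * sin x / 3).
  { apply (le_of_derive_nonneg (fun x => sin x - x * cos x - x ^ 2 * sin x / 3)
             (fun x => x / 3 * (sin x - x * cos x))).
    - lra.
    - intros t _; auto_derive; [easy | field].
    - intros t Ht; pose proof (mul_cos_le_sin t ltac:(lra)); nra. }
  rewrite sin_0 in H; lra.
Qed.

(* [x |-> sin x / x * exp (x ^ 2 / 6)] is decreasing on (0, PI]. *)
Lemma sinc_gaussian_decreasing (s a : R) :
  0 < s -> s <= a -> a <= PI ->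
  s * sin a * exp ((a ^ 2 - s ^ 2) / 6) <= a * sin s.
Proof.
  intros Hs Hsa Ha.
  assert (H : - (sin s / s * exp (s ^ 2 / 6)) <= - (sin a / a * exp (a ^ 2 / 6))).
  { apply (le_of_derive_nonneg (fun x => - (sin x / x * exp (x ^ 2 / 6)))
       (fun x => (sin x - (x * cos x + x ^ 2 * sin x / 3)) / x ^ 2 * exp (x ^ 2 / 6))).
    - lra.
    - intros t Ht; auto_derive; [lra |].
      change (exp (t * (t * 1) * / 6)) with (exp (t ^ 2 / 6)); field; lra.
    - intros t Ht.
      apply Rmult_le_pos; [| left; apply exp_pos].
      apply Rdiv_le_0_compat; [| nra].
      pose proof (mul_cos_quadratic_le_sin t ltac:(lra)); lra. }
  replace (exp (a ^ 2 / 6)) with (exp ((a ^ 2 - s ^ 2) / 6) * exp (s ^ 2 / 6)) in H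
    by (rewrite <- exp_plus; f_equal; lra).
  pose proof (exp_pos (s ^ 2 / 6)) as Hp.
  set (E := exp ((a ^ 2 - s ^ 2) / 6)) in *.
  assert (H1 : sin a / a * E <= sin s / s) by nra.
  apply (Rmult_le_compat_r (s * a)) in H1; [| nra].
  replace (sin a / a * E * (s * a)) with (s * sin a * E) in H1 by (field; lra).
  replace (sin s / s * (s * a)) with (a * sin s) in H1 by (field; lra).
  exact H1.
Qed.

(** The limit [s -> 0] of [sinc_gaussian_decreasing], where [sin s / s] tends to 1. Instead of a
    limit, a small explicit [s] refutes the opposite inequality. *)
Lemma sin_gaussian_le (a : R) : 0 <= a <= PI -> sin a * exp (a ^ 2 / 6) <= a.
Proof.
  intros [[Ha | <-] Ha']; [| rewrite sin_0; lra].
  apply Rnot_lt_le; intros Hlt.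
  set (P := sin a * exp (a ^ 2 / 6)) in *.
  assert (HP : 0 < P) by lra.
  (* Monotonicity will give [P * (1 - s ^ 2 / 6) <= a]; with [s <= 1] and [s * P <= P - a] this
     yields [P - a <= (P - a) / 6], a contradiction. *)
  set (s := Rmin (Rmin a 1) ((P - a) / P)).
  assert (Hs0 : 0 < s).
  { repeat apply Rmin_glb_lt; try lra. apply Rdiv_lt_0_compat; lra. }
  assert (Hs : s <= a /\ s <= 1 /\ s <= (P - a) / P).
  { unfold s; pose proof (Rmin_l (Rmin a 1) ((P - a) / P)).
    pose proof (Rmin_r (Rmin a 1) ((P - a) / P)).
    pose proof (Rmin_l a 1); pose proof (Rmin_r a 1); lra. }
  destruct Hs as [Hsa [Hs1 Hs2]].
  assert (HsP : s * P <= P - a).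
  { apply (Rmult_le_compat_r P) in Hs2; [| lra].
    replace ((P - a) / P * P) with (P - a) in Hs2 by (field; lra). lra. }
  pose proof (sinc_gaussian_decreasing s a Hs0 Hsa Ha') as H.
  replace (exp ((a ^ 2 - s ^ 2) / 6)) with (exp (a ^ 2 / 6) * exp (- (s ^ 2 / 6))) in H
    by (rewrite <- exp_plus; f_equal; lra).
  pose proof (exp_ineq1_le (- (s ^ 2 / 6))) as He.
  set (e := exp (- (s ^ 2 / 6))) in *.
  replace (s * sin a * (exp (a ^ 2 / 6) * e)) with (s * (P * e)) in H
    by (unfold P; ring).
  pose proof (sin_le_self s ltac:(lra)).
  assert (P * e <= a) by nra.
  nra.
Qed.

(** Comparing [sin s / s] with its value [2 / PI] at [PI / 2], and [PI <= 4]. *)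
Lemma half_le_sin (s : R) : 0 <= s <= PI / 2 -> s / 2 <= sin s.
Proof.
  intros [[Hs | <-] Hs']; [| rewrite sin_0; lra].
  pose proof PI_4; pose proof PI_RGT_0.
  pose proof (sinc_gaussian_decreasing s (PI / 2) Hs Hs' ltac:(lra)) as H1.
  rewrite sin_PI2 in H1.
  pose proof (exp_ineq1_le (((PI / 2) ^ 2 - s ^ 2) / 6)).
  assert (0 <= ((PI / 2) ^ 2 - s ^ 2) / 6) by nra.
  nra.
Qed.

(** The right side is the square of [exp (t / 2) - exp (- (t / 2))], that is of 2 sinh(t/2), which
    is at least [t] for [t >= 0]. *)
Lemma sq_le_exp_add_exp_opp (t : R) : t ^ 2 <= exp t + exp (- t) - 2.
Proof.
  assert (Hpos : forall t, 0 <= t -> t ^ 2 <= exp t + exp (- t) - 2).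
  { clear t; intros t Ht.
    set (p := exp (t / 2)); set (r := exp (- (t / 2))).
    assert (Hpr : p * r = 1)
      by (unfold p, r; rewrite <- exp_plus, Rplus_opp_r; apply exp_0).
    replace (exp t) with (p * p) by (unfold p; rewrite <- exp_plus; f_equal; lra).
    replace (exp (- t)) with (r * r) by (unfold r; rewrite <- exp_plus; f_equal; lra).
    assert (H : t <= p - r).
    { enough (exp (0 / 2) - exp (- (0 / 2)) - 0 <= p - r - t) as H
        by (replace (0 / 2) with 0 in H by lra; rewrite Ropp_0, exp_0 in H; lra).
      apply (le_of_derive_nonneg (fun t => exp (t / 2) - exp (- (t / 2)) - t)
              (fun t => (exp (t / 2) + exp (- (t / 2))) / 2 - 1)); [lra | |].
      - intros x _; auto_derive; [easy | unfold Rdiv; field].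
      - intros x _.
        assert (exp (x / 2) * exp (- (x / 2)) = 1)
          by (rewrite <- exp_plus, Rplus_opp_r; apply exp_0).
        pose proof (exp_pos (x / 2)); pose proof (exp_pos (- (x / 2))).
        pose proof (pow2_ge_0 (exp (x / 2) - exp (- (x / 2)))); nra. }
    nra. }
  destruct (Rle_dec 0 t) as [Ht | Ht]; [now apply Hpos |].
  pose proof (Hpos (- t) ltac:(lra)) as H; rewrite Ropp_involutive in H; nra.
Qed.

(** * Squared distances under the exponential *)

Definition sqdist (z w : C) : R := (fst z - fst w) ^ 2 + (snd z - snd w) ^ 2.

(** This is |e^z - e^w| = |e^((z+w)/2)| |2 sinh((z-w)/2)| squared, combined with |sinh(a+bi)|^2 =
    sinh^2 a + sin^2 b. *)
Lemma sqdist_Cexp (z w : C) :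
  sqdist (Cexp z) (Cexp w) =
  exp (fst z + fst w) *
  (exp (fst z - fst w) + exp (- (fst z - fst w)) - 2
   + 4 * sin ((snd z - snd w) / 2) ^ 2).
Proof.
  destruct z as [x y], w as [u v]; unfold sqdist, Cexp; cbn [fst snd].
  assert (Hc : 4 * sin ((y - v) / 2) ^ 2 = 2 - 2 * (cos y * cos v + sin y * sin v)).
  { rewrite <- cos_minus.
    replace (cos (y - v)) with (cos (2 * ((y - v) / 2))) by (f_equal; lra).
    rewrite cos_2a_sin; ring. }
  rewrite Hc.
  replace (exp (x - u)) with (exp x * exp (- u)) by (rewrite <- exp_plus; f_equal; lra).
  replace (exp (- (x - u))) with (exp u * exp (- x)) by (rewrite <- exp_plus; f_equal; lra).
  rewrite exp_plus.
  assert (Hx : exp x * exp (- x) = 1) by (rewrite <- exp_plus, Rplus_opp_r; apply exp_0).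
  assert (Hu : exp u * exp (- u) = 1) by (rewrite <- exp_plus, Rplus_opp_r; apply exp_0).
  pose proof (sin2_cos2 y) as Hy; pose proof (sin2_cos2 v) as Hv; unfold Rsqr in *.
  transitivity (exp x ^ 2 * (sin y * sin y + cos y * cos y)
    + exp u ^ 2 * (sin v * sin v + cos v * cos v)
    - 2 * exp x * exp u * (cos y * cos v + sin y * sin v)); [ring |].
  rewrite Hy, Hv.
  transitivity (exp x ^ 2 * (exp u * exp (- u)) + exp u ^ 2 * (exp x * exp (- x))
    - 2 * exp x * exp u * (cos y * cos v + sin y * sin v)); [rewrite Hx, Hu | ]; ring.
Qed.

Lemma sqdist_Cexp_ge (z w : C) :
  exp (fst z + fst w) * ((fst z - fst w) ^ 2 + 4 * sin ((snd z - snd w) / 2) ^ 2)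
  <= sqdist (Cexp z) (Cexp w).
Proof.
  rewrite sqdist_Cexp; apply Rmult_le_compat_l; [left; apply exp_pos |].
  pose proof (sq_le_exp_add_exp_opp (fst z - fst w)); lra.
Qed.

(** The hypothesis keeps half the difference of imaginary parts within [PI / 2], where [half_le_sin]
    applies and costs the factor 4. This will be the Lipschitz bound for logarithms. *)
Lemma Cexp_expansion (z w : C) :
  Rabs (snd z - snd w) <= PI ->
  exp (fst z + fst w) * sqdist z w <= 4 * sqdist (Cexp z) (Cexp w).
Proof.
  intros H.
  pose proof (sqdist_Cexp_ge z w) as H1.
  pose proof (exp_pos (fst z + fst w)) as Hp.
  assert (Hs : ((snd z - snd w) / 4) ^ 2 <= sin ((snd z - snd w) / 2) ^ 2).
  { set (s := (snd z - snd w) / 2).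
    replace ((snd z - snd w) / 4) with (s / 2) by (unfold s; lra).
    assert (Hs : Rabs s <= PI / 2).
    { unfold s, Rdiv; rewrite Rabs_mult, (Rabs_pos_eq (/ 2)) by lra; lra. }
    destruct (Rle_dec 0 s).
    - rewrite Rabs_pos_eq in Hs by lra.
      pose proof (half_le_sin s ltac:(lra)); nra.
    - rewrite Rabs_left in Hs by lra.
      pose proof (half_le_sin (- s) ltac:(lra)) as H2; rewrite sin_neg in H2; nra. }
  unfold sqdist at 1.
  pose proof (pow2_ge_0 (fst z - fst w)).
  assert (exp (fst z + fst w) * ((fst z - fst w) ^ 2 + (snd z - snd w) ^ 2)
     <= 4 * (exp (fst z + fst w) *
       ((fst z - fst w) ^ 2 + 4 * sin ((snd z - snd w) / 2) ^ 2))); [| lra].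
  nra.
Qed.

(* With [a = (y + v) / 2] and [s = (y - v) / 2] one has [y v = a^2 - s^2] and
   [sin y sin v = sin^2 a - sin^2 s]. *)
Lemma sin_half_diff_bound (y v : R) :
  0 < y < PI -> 0 < v < PI ->
  exp (y * v / 3) * (y - v) ^ 2 * (sin y * sin v)
  <= 4 * sin ((y - v) / 2) ^ 2 * (y * v).
Proof.
  assert (Hwlog : forall y v, 0 < y < PI -> 0 < v < PI -> v <= y ->
    exp (y * v / 3) * (y - v) ^ 2 * (sin y * sin v)
    <= 4 * sin ((y - v) / 2) ^ 2 * (y * v)).
  { clear y v; intros y v Hy Hv [Hvy | <-].
    2: { replace ((v - v) / 2) with 0 by lra. rewrite sin_0. nra. }
    set (a := (y + v) / 2); set (s := (y - v) / 2).
    assert (Hs : 0 < s < a) by (unfold a, s; lra).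
    assert (Ha : a < PI) by (unfold a; lra).
    replace y with (a + s) by (unfold a, s; lra).
    replace v with (a - s) by (unfold a, s; lra).
    replace ((a + s - (a - s)) / 2) with s by lra.
    pose proof (sinc_gaussian_decreasing s a ltac:(lra) ltac:(lra) ltac:(lra)) as H.
    replace (exp ((a + s) * (a - s) / 3))
      with (exp ((a ^ 2 - s ^ 2) / 6) ^ 2).
    2: { rewrite <- Rsqr_pow2; unfold Rsqr; rewrite <- exp_plus; f_equal; lra. }
    set (e := exp ((a ^ 2 - s ^ 2) / 6)) in *.
    assert (He : 1 <= e).
    { unfold e; pose proof (exp_ineq1_le ((a ^ 2 - s ^ 2) / 6)).
      assert (0 <= (a ^ 2 - s ^ 2) / 6) by nra; lra. }
    replace (sin (a + s) * sin (a - s)) with (sin a ^ 2 - sin s ^ 2).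
    2: { rewrite sin_plus, sin_minus.
         pose proof (sin2_cos2 a); pose proof (sin2_cos2 s); unfold Rsqr in *.
         transitivity (sin a ^ 2 * (1 - sin s * sin s)
                       - sin s ^ 2 * (1 - sin a * sin a)); [ring |].
         replace (1 - sin s * sin s) with (cos s * cos s) by lra.
         replace (1 - sin a * sin a) with (cos a * cos a) by lra.
         ring. }
    pose proof (sin_ge_0 a ltac:(lra) ltac:(lra)).
    pose proof (sin_ge_0 s ltac:(lra) ltac:(lra)).
    (* Up to the factor 4 the goal is [e^2 s^2 (sin^2 a - sin^2 s) <= sin^2 s (a^2 - s^2)]. [Hsq]
       compares the first terms of both sides, and [e >= 1] the second ones. *)
    assert (Hsq : (s * sin a * e) ^ 2 <= (a * sin s) ^ 2).
    { apply pow_incr; split; [| exact H].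
      apply Rmult_le_pos; [apply Rmult_le_pos |]; lra. }
    assert (He2 : 1 <= e ^ 2) by nra.
    assert (0 <= (e ^ 2 - 1) * (s ^ 2 * sin s ^ 2)).
    { apply Rmult_le_pos; [lra |]; apply Rmult_le_pos; apply pow2_ge_0. }
    replace (a + s - (a - s)) with (2 * s) by ring.
    nra. }
  intros Hy Hv.
  destruct (Rle_dec v y) as [H | H]; [now apply Hwlog |].
  pose proof (Hwlog v y Hv Hy ltac:(lra)) as H1.
  replace ((v - y) / 2) with (- ((y - v) / 2)) in H1 by lra.
  rewrite sin_neg, (Rmult_comm v y) in H1.
  nra.
Qed.

(* The principal logarithm contracts the hyperbolic metric of the upper half
   plane, measured by [|z - w|^2 / (Im z Im w)], with an explicit gain. *)
Lemma Cexp_hyperbolic_expansion (z w : C) :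
  0 < snd z < PI -> 0 < snd w < PI ->
  exp (snd z * snd w / 3) * sqdist z w * (snd (Cexp z) * snd (Cexp w))
  <= sqdist (Cexp z) (Cexp w) * (snd z * snd w).
Proof.
  intros Hz Hw.
  pose proof (sqdist_Cexp_ge z w) as H1.
  pose proof (sin_half_diff_bound _ _ Hz Hw) as H2.
  pose proof (sin_gaussian_le (snd z) ltac:(lra)) as Sz.
  pose proof (sin_gaussian_le (snd w) ltac:(lra)) as Sw.
  pose proof (sin_gt_0 (snd z) ltac:(lra) ltac:(lra)) as Pz.
  pose proof (sin_gt_0 (snd w) ltac:(lra) ltac:(lra)) as Pw.
  destruct z as [x y], w as [u v]; unfold sqdist at 1; cbn [fst snd] in *.
  unfold Cexp at 1 2; cbn [fst snd].
  set (E := exp (y * v / 3)) in *.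
  assert (H3 : E * (sin y * sin v) <= y * v).
  { assert (HE : E <= exp (y ^ 2 / 6) * exp (v ^ 2 / 6)).
    { unfold E; rewrite <- exp_plus.
      assert (Hle : y * v / 3 <= y ^ 2 / 6 + v ^ 2 / 6)
        by (pose proof (pow2_ge_0 (y - v)); nra).
      destruct Hle as [Hlt | ->]; [left; now apply exp_increasing | right; reflexivity]. }
    assert (Hp : (sin y * exp (y ^ 2 / 6)) * (sin v * exp (v ^ 2 / 6)) <= y * v).
    { apply Rmult_le_compat; try assumption;
        (apply Rmult_le_pos; [lra | left; apply exp_pos]). }
    assert (0 < sin y * sin v) by (now apply Rmult_lt_0_compat).
    nra. }
  rewrite exp_plus in H1.
  pose proof (Rmult_lt_0_compat _ _ (exp_pos x) (exp_pos u)) as Hp.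
  set (P := exp x * exp u) in *.
  apply Rle_trans with (P * ((x - u) ^ 2 + 4 * sin ((y - v) / 2) ^ 2) * (y * v)).
  2: { apply Rmult_le_compat_r; [apply Rmult_le_pos; lra | exact H1]. }
  replace (exp x * sin y * (exp u * sin v)) with (P * (sin y * sin v))
    by (unfold P; ring).
  (* The horizontal and vertical parts separate: [H3] bounds the first, [sin_half_diff_bound] the
     second. *)
  replace (E * ((x - u) ^ 2 + (y - v) ^ 2) * (P * (sin y * sin v))) with
    (P * ((x - u) ^ 2 * (E * (sin y * sin v)) + E * (y - v) ^ 2 * (sin y * sin v)))
    by ring.
  rewrite (Rmult_assoc P); apply Rmult_le_compat_l; [lra |].
  pose proof (pow2_ge_0 (x - u)); nra.
Qed.

(** * Density of the preimages of the real axis *)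

Lemma polar_upper (h : C) :
  0 < snd h -> exists u v, 0 < v < PI /\ Cexp (u, v) = h.
Proof.
  destruct h as [x y]; cbn [snd]; intros Hy.
  set (m := sqrt (x ^ 2 + y ^ 2)).
  assert (Hs : 0 < x ^ 2 + y ^ 2) by nra.
  assert (Hm : 0 < m) by (now apply sqrt_lt_R0).
  assert (Hm2 : m * m = x ^ 2 + y ^ 2) by (apply sqrt_def; lra).
  assert (Hxm : - m < x < m) by nra.
  assert (Hc : -1 < x / m < 1).
  { split; [apply Rlt_div_r | apply Rlt_div_l]; lra. }
  exists (ln m), (acos (x / m)); unfold Cexp; cbn [fst snd].
  rewrite exp_ln, cos_acos, sin_acos by lra.
  assert (Hsin : sqrt (1 - (x / m)²) = y / m).
  { apply sqrt_lem_1.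
    - unfold Rsqr; nra.
    - apply Rdiv_le_0_compat; lra.
    - unfold Rsqr; replace (y / m * (y / m)) with ((m * m - x ^ 2) / (m * m)).
      + field; lra.
      + rewrite Hm2; replace (x ^ 2 + y ^ 2 - x ^ 2) with (y * y) by ring.
        rewrite <- Hm2; field; lra. }
  split.
  - pose proof (acos_bound (x / m)) as Hb.
    assert (H : 0 < sin (acos (x / m))).
    { rewrite sin_acos, Hsin by lra; now apply Rdiv_lt_0_compat. }
    destruct Hb as [[H0 | E0] [H1 | E1]]; try lra; exfalso.
    + rewrite E1, sin_PI in H; lra.
    + rewrite <- E0, sin_0 in H; lra.
    + rewrite <- E0, sin_0 in H; lra.
  - rewrite Hsin; f_equal; field; lra.
Qed.

Lemma Cexp_shift (j : nat) (u v : R) :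
  Cexp (u, v + INR j * PI)
  = ((-1) ^ j * fst (Cexp (u, v)), (-1) ^ j * snd (Cexp (u, v))).
Proof.
  unfold Cexp; cbn [fst snd].
  enough (cos (v + INR j * PI) = (-1) ^ j * cos v /\
          sin (v + INR j * PI) = (-1) ^ j * sin v) as [-> ->] by (f_equal; ring).
  induction j as [| j [IHc IHs]].
  - simpl INR; rewrite Rmult_0_l, Rplus_0_r; simpl; lra.
  - replace (v + INR (S j) * PI) with (v + INR j * PI + PI) by (rewrite S_INR; ring).
    rewrite neg_cos, neg_sin, IHc, IHs; simpl; lra.
Qed.

Lemma sign_sq (j : nat) : (-1) ^ j * (-1) ^ j = 1.
Proof. rewrite <- Rpow_mult_distr, <- (pow1 j); f_equal; lra. Qed.

(* [hyp_le K z w]: [z] and [w] lie in the same open half plane off the real axis,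
   with hyperbolic distance [d] such that [2 (cosh d - 1) <= K]. *)
Definition hyp_le (K : R) (z w : C) : Prop :=
  0 < snd z * snd w /\ sqdist z w <= K * (snd z * snd w).

Lemma hyp_le_nonneg (K : R) (z w : C) : hyp_le K z w -> 0 <= K.
Proof.
  intros [H1 H2]; unfold sqdist in H2.
  pose proof (pow2_ge_0 (fst z - fst w)); pose proof (pow2_ge_0 (snd z - snd w)).
  nra.
Qed.

(** On each horizontal strip of height [PI], [Cexp] is up to sign a translate of its restriction to
    the lowest strip, whose inverse contracts the hyperbolic metric. Translating up by [j * PI]
    increases heights and so only shrinks hyperbolic distances. *)
Lemma hyp_le_pullback_upper (K : R) (w q' : C) :
  0 < snd w -> hyp_le K (Cexp w) q' ->
  exists q, Cexp q = q' /\ hyp_le K w q /\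
    (1 / 2 <= snd w -> K <= 7 -> hyp_le (108 / 109 * K) w q).
Proof.
  intros Hw HQ.
  pose proof (hyp_le_nonneg _ _ _ HQ) as HK.
  destruct w as [x Y]; cbn [snd] in *.
  pose proof PI_RGT_0 as Hpi.
  destruct (nfloor_ex (Y / PI)) as [j [Hj1 Hj2]].
  { apply Rdiv_le_0_compat; lra. }
  apply Rle_div_r in Hj1; [| lra]. apply Rlt_div_l in Hj2; [| lra].
  set (y := Y - INR j * PI).
  assert (HY : Y = y + INR j * PI) by (unfold y; ring).
  assert (Hy : 0 <= y < PI) by (unfold y; lra).
  clearbody y; subst Y.
  rewrite Cexp_shift in HQ.
  pose proof (sign_sq j) as Hsg; set (e := (-1) ^ j) in *.
  destruct q' as [q1 q2]; destruct HQ as [HQ1 HQ2]; cbn [fst snd] in HQ1, HQ2.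
  assert (Hyp : 0 < y).
  { destruct Hy as [[Hy | <-] _]; [exact Hy | exfalso].
    unfold Cexp in HQ1; cbn [snd] in HQ1; rewrite sin_0 in HQ1; lra. }
  assert (Hsy : 0 < snd (Cexp (x, y))).
  { unfold Cexp; cbn [fst snd]; apply Rmult_lt_0_compat;
      [apply exp_pos | apply sin_gt_0; lra]. }
  destruct (polar_upper (e * q1, e * q2)) as [u [v [Hv Hq]]].
  { cbn [snd]; nra. }
  exists (u, v + INR j * PI).
  split.
  { rewrite Cexp_shift, Hq; fold e; cbn [fst snd].
    f_equal; [transitivity (e * e * q1) | transitivity (e * e * q2)];
      try ring; rewrite Hsg; ring. }
  assert (Hmain : exp (y * v / 3) * sqdist (x, y) (u, v) <= K * (y * v)).
  { pose proof (Cexp_hyperbolic_expansion (x, y) (u, v) ltac:(cbn; lra) ltac:(cbn; lra)) as H.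
    rewrite Hq in H; cbn [snd] in H.
    assert (Hd : sqdist (Cexp (x, y)) (e * q1, e * q2)
       = sqdist (e * fst (Cexp (x, y)), e * snd (Cexp (x, y))) (q1, q2)).
    { unfold sqdist; cbn [fst snd].
      set (A := fst (Cexp (x, y))); set (B := snd (Cexp (x, y))).
      transitivity (A ^ 2 + B ^ 2 - 2 * e * (A * q1 + B * q2)
                    + (e * e) * (q1 ^ 2 + q2 ^ 2)); [ring |].
      transitivity ((e * e) * (A ^ 2 + B ^ 2) - 2 * e * (A * q1 + B * q2)
                    + (q1 ^ 2 + q2 ^ 2)); [rewrite Hsg |]; ring. }
    rewrite Hd in H.
    replace (e * snd (Cexp (x, y)) * q2) with (snd (Cexp (x, y)) * (e * q2)) in *
      by ring.
    set (S := snd (Cexp (x, y)) * (e * q2)) in *.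
    assert (0 < y * v) by (apply Rmult_lt_0_compat; lra).
    apply (Rmult_le_compat_r (y * v)) in HQ2; [| lra].
    apply (Rmult_le_reg_r S); [exact HQ1 |]. lra. }
  assert (Hyv : 0 < y * v) by (apply Rmult_lt_0_compat; lra).
  assert (HE : 1 + y * v / 3 <= exp (y * v / 3)) by apply exp_ineq1_le.
  assert (Hd0 : 0 <= sqdist (x, y) (u, v)).
  { unfold sqdist; apply Rplus_le_le_0_compat; apply pow2_ge_0. }
  assert (Hd1 : sqdist (x, y) (u, v) <= K * (y * v)) by nra.
  unfold hyp_le; cbn [snd].
  replace (sqdist (x, y + INR j * PI) (u, v + INR j * PI)) with (sqdist (x, y) (u, v))
    by (unfold sqdist; cbn [fst snd]; ring).
  destruct j as [| j].
  - simpl INR; rewrite Rmult_0_l, !Rplus_0_r.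
    split; [split; assumption |].
    intros Hy2 HK7; split; [assumption |].
    (* [K <= 7] gives [(y - v)^2 <= 7 y v], hence [y <= 9 v], so [y >= 1 / 2] forces
       [y v >= 1 / 36]. The gain [1 + y v / 3] is then at least [109 / 108]. *)
    assert (Hv9 : 1 / 36 <= y * v).
    { assert (Hs : (y - v) ^ 2 <= 7 * (y * v)).
      { unfold sqdist in Hd1; cbn [fst snd] in Hd1.
        pose proof (pow2_ge_0 (x - u)).
        assert (K * (y * v) <= 7 * (y * v)) by nra. lra. }
      assert (y <= 9 * v) by nra. nra. }
    assert (109 / 108 * sqdist (x, y) (u, v) <= K * (y * v)) by nra.
    lra.
  (* In a higher strip [J >= PI] exceeds both [y] and [v], so the translation at least doubles each
     height and gains a factor 4. *)
  - assert (HJ : PI <= INR (S j) * PI).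
    { rewrite S_INR; pose proof (pos_INR j); nra. }
    set (J := INR (S j) * PI) in *.
    assert (H4 : 4 * (y * v) <= (y + J) * (v + J)) by nra.
    assert (H5 : 4 * (K * (y * v)) <= K * ((y + J) * (v + J))) by nra.
    split; [split; nra |]. intros _ _; split; nra.
Qed.

Lemma Cexp_Cconj (z : C) : Cexp (Cconj z) = Cconj (Cexp z).
Proof.
  unfold Cexp, Cconj; cbn [fst snd]; rewrite cos_neg, sin_neg; f_equal; ring.
Qed.

Lemma hyp_le_Cconj (K : R) (z w : C) : hyp_le K z w -> hyp_le K (Cconj z) (Cconj w).
Proof.
  unfold hyp_le, sqdist, Cconj; cbn [fst snd].
  replace (- snd z * - snd w) with (snd z * snd w) by ring.
  replace ((- snd z - - snd w) ^ 2) with ((snd z - snd w) ^ 2) by ring.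
  easy.
Qed.

Lemma hyp_le_pullback (K : R) (w q' : C) :
  snd w <> 0 -> hyp_le K (Cexp w) q' ->
  exists q, Cexp q = q' /\ hyp_le K w q /\
    (1 / 2 <= Rabs (snd w) -> K <= 7 -> hyp_le (108 / 109 * K) w q).
Proof.
  intros Hw HQ.
  destruct (Rlt_or_le 0 (snd w)) as [H | H].
  - rewrite Rabs_pos_eq by lra; now apply hyp_le_pullback_upper.
  - destruct (hyp_le_pullback_upper K (Cconj w) (Cconj q')) as [q [H1 [H2 H3]]].
    + cbn [Cconj snd]; lra.
    + rewrite Cexp_Cconj; now apply hyp_le_Cconj.
    + exists (Cconj q); split; [| split].
      * rewrite Cexp_Cconj, H1; apply Cconj_conj.
      * rewrite <- (Cconj_conj w); now apply hyp_le_Cconj.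
      * intros Ha HK7; rewrite <- (Cconj_conj w); apply hyp_le_Cconj, H3; [| exact HK7].
        rewrite Rabs_left in Ha by lra; exact Ha.
Qed.

Lemma iter_add (g : Cplx -> Cplx) (n m : nat) (z : Cplx) :
  iter (n + m) g z = iter n g (iter m g z).
Proof. induction n as [| n IH]; simpl; [easy | now rewrite IH]. Qed.

Lemma iter_S_inside (g : Cplx -> Cplx) (n : nat) (z : Cplx) :
  iter (S n) g z = iter n g (g z).
Proof. replace (S n) with (n + 1)%nat by lia; now rewrite iter_add. Qed.

(** * Orbits avoiding the real axis *)

Definition never_real (z : C) : Prop := forall k, snd (iter k Cexp z) <> 0.

Lemma never_real_iter (z : C) (n : nat) : never_real z -> never_real (iter n Cexp z).
Proof. intros H k; rewrite <- iter_add; apply H. Qed.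

Lemma hyp_le_pullback_iter (K : R) (n : nat) : forall w q : C,
  never_real w -> hyp_le K (iter n Cexp w) q ->
  exists q0, iter n Cexp q0 = q /\ hyp_le K w q0.
Proof.
  induction n as [| n IH]; intros w q Hw HQ.
  - exists q; split; [easy | exact HQ].
  - rewrite iter_S_inside in HQ.
    destruct (IH (Cexp w) q (never_real_iter w 1 Hw) HQ) as [q1 [H1 H2]].
    destruct (hyp_le_pullback K w q1 (Hw 0%nat) H2) as [q0 [H3 [H4 _]]].
    exists q0; split; [| exact H4].
    now rewrite iter_S_inside, H3.
Qed.

(* An orbit staying near the real axis would have real part tending to infinity,
   and then [Cexp] would at least double the imaginary part at each step. *)
Lemma never_real_leaves_strip (w : C) :
  never_real w -> exists n, 1 / 2 <= Rabs (snd (iter n Cexp w)).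
Proof.
  intros Hw; apply NNPP; intros Hno.
  assert (Hsm : forall n, Rabs (snd (iter n Cexp w)) < 1 / 2).
  { intros n; apply Rnot_le_lt; intros H; apply Hno; now exists n. }
  clear Hno.
  assert (Hcos : forall y, Rabs y < 1 / 2 -> 7 / 8 <= cos y).
  { intros y Hy.
    replace y with (2 * (y / 2)) by lra; rewrite cos_2a_sin.
    assert (Hs : sin (y / 2) ^ 2 <= (y / 2) ^ 2).
    { destruct (Rle_dec 0 y).
      - rewrite Rabs_pos_eq in Hy by lra.
        pose proof (sin_le_self (y / 2) ltac:(lra)).
        pose proof (sin_ge_0 (y / 2) ltac:(lra) ltac:(pose proof PI2_1; lra)); nra.
      - rewrite Rabs_left in Hy by lra.
        pose proof (sin_le_self (- (y / 2)) ltac:(lra)) as H1.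
        pose proof (sin_ge_0 (- (y / 2)) ltac:(lra) ltac:(pose proof PI2_1; lra)) as H2.
        rewrite sin_neg in H1, H2; nra. }
    apply Rabs_def2 in Hy; nra. }
  assert (Hsin : forall y, Rabs y < 1 / 2 -> 1 / 2 * Rabs y <= Rabs (sin y)).
  { intros y Hy; pose proof PI2_1.
    destruct (Rle_dec 0 y).
    - rewrite Rabs_pos_eq in * by lra.
      pose proof (half_le_sin y ltac:(lra)).
      rewrite Rabs_pos_eq by lra; lra.
    - rewrite Rabs_left in * by lra.
      pose proof (half_le_sin (- y) ltac:(lra)) as H1; rewrite sin_neg in H1.
      rewrite Rabs_left1 by lra; lra. }
  (* The real part grows by [1 / 2] per step because [t + 1 / 2 <= 7 / 8 * exp t]: the bound
     [exp t >= 1 + t] suffices up to [t = 3], its version at [t / 2], squared, beyond. *)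
  assert (Hx : forall n, fst w + INR n / 2 <= fst (iter n Cexp w)).
  { induction n as [| n IH]; [simpl; lra |].
    rewrite S_INR; cbn [iter]; unfold Cexp at 1; cbn [fst].
    pose proof (Hcos _ (Hsm n)) as Hc.
    set (t := fst (iter n Cexp w)) in *; set (c := cos (snd (iter n Cexp w))) in *.
    assert (t + 1 / 2 <= 7 / 8 * exp t).
    { destruct (Rle_dec t 3).
      - pose proof (exp_ineq1_le t); lra.
      - pose proof (exp_ineq1_le (t / 2)).
        replace (exp t) with (exp (t / 2) * exp (t / 2))
          by (rewrite <- exp_plus; f_equal; lra).
        nra. }
    pose proof (exp_pos t); nra. }
  destruct (nfloor_ex (2 * Rabs (3 - fst w))) as [n0 [_ Hn0]].
  { pose proof (Rabs_pos (3 - fst w)); lra. }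
  assert (Hx3 : forall k, 3 <= fst (iter (k + S n0) Cexp w)).
  { intros k; pose proof (Hx (k + S n0)%nat) as H.
    rewrite plus_INR, S_INR in H; pose proof (pos_INR k).
    pose proof (Rle_abs (3 - fst w)); lra. }
  set (y0 := Rabs (snd (iter (S n0) Cexp w))).
  assert (Hy0 : 0 < y0) by (apply Rabs_pos_lt, Hw).
  (* Once the real part is at least 3, its exponential is at least 4, which against
     [1 / 2 * Rabs y <= Rabs (sin y)] doubles the imaginary part. *)
  assert (Hgrow : forall k, y0 * 2 ^ k <= Rabs (snd (iter (k + S n0) Cexp w))).
  { induction k as [| k IH]; [simpl pow; rewrite Rmult_1_r; apply Rle_refl |].
    replace (S k + S n0)%nat with (S (k + S n0)) by lia.
    cbn [iter]; unfold Cexp at 1; cbn [snd pow].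
    pose proof (Hx3 k) as H3; pose proof (Hsin _ (Hsm (k + S n0)%nat)) as Hs.
    rewrite Rabs_mult, (Rabs_pos_eq (exp _)) by (left; apply exp_pos).
    set (t := fst (iter (k + S n0) Cexp w)) in *.
    set (y := snd (iter (k + S n0) Cexp w)) in *.
    pose proof (exp_ineq1_le t); pose proof (Rabs_pos y); nra. }
  destruct (Pow_x_infinity 2 ltac:(rewrite Rabs_pos_eq; lra) (/ y0)) as [N HN].
  specialize (HN N (Nat.le_refl N)).
  rewrite Rabs_pos_eq in HN by (apply pow_le; lra).
  pose proof (Hgrow N); pose proof (Hsm (N + S n0)%nat).
  apply Rge_le in HN; apply (Rmult_le_compat_l y0) in HN; [| lra].
  rewrite Rinv_r in HN by lra; lra.
Qed.

(** The orbit returns to [Rabs (snd _) >= 1 / 2] again and again. Each of [N] such visits before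
    time [n] contributes a factor [108 / 109] to the pullback, and the steps in between lose
    nothing. *)
Lemma hyp_le_strong_pullback (z : C) (N : nat) :
  never_real z ->
  exists n, 1 / 2 <= Rabs (snd (iter n Cexp z)) /\
    forall K q, K <= 7 -> hyp_le K (iter n Cexp z) q ->
      exists q0, iter n Cexp q0 = q /\ hyp_le ((108 / 109) ^ N * K) z q0.
Proof.
  intros Hz; induction N as [| N [n [Hn IH]]].
  - destruct (never_real_leaves_strip z Hz) as [n Hn]; exists n; split; [exact Hn |].
    intros K q _ HQ; simpl pow; rewrite Rmult_1_l.
    now apply hyp_le_pullback_iter.
  - set (w := iter n Cexp z) in *.
    destruct (never_real_leaves_strip (Cexp w)) as [m Hm].
    { exact (never_real_iter z (S n) Hz). }
    assert (E : forall p, iter (m + S n) Cexp p = iter m Cexp (Cexp (iter n Cexp p)))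
      by (intros p; now rewrite iter_add).
    exists (m + S n)%nat; split; [now rewrite E |].
    intros K q HK HQ; rewrite E in HQ.
    destruct (hyp_le_pullback_iter K m (Cexp w) q) as [q1 [H1 H2]];
      [exact (never_real_iter z (S n) Hz) | exact HQ |].
    pose proof (hyp_le_nonneg _ _ _ H2) as HK0.
    destruct (hyp_le_pullback K w q1 (Hz n) H2) as [q2 [H3 [_ H4]]].
    destruct (IH (108 / 109 * K) q2 ltac:(lra) (H4 Hn HK)) as [q0 [H5 H6]].
    exists q0; split; [now rewrite E, H5, H3 |].
    replace ((108 / 109) ^ S N * K) with ((108 / 109) ^ N * (108 / 109 * K))
      by (simpl; ring).
    exact H6.
Qed.

Lemma snd_Cexp_mul_PI (u : R) (k : nat) : snd (Cexp (u, INR k * PI)) = 0.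
Proof.
  rewrite <- (Rplus_0_l (INR k * PI)), Cexp_shift.
  unfold Cexp; cbn [fst snd]; rewrite sin_0; ring.
Qed.

(** In the upper half plane [q] sits straight above [w], at the next multiple [T] of [PI]. If
    [PI <= y], then [T - y <= PI <= y]; otherwise [T = PI], and [y >= 1 / 2] with [PI <= 4] gives
    the constant 7. Conjugation handles the lower half plane. *)
Lemma exists_hyp_close_to_preimage_of_reals (w : C) :
  1 / 2 <= Rabs (snd w) -> exists q, hyp_le 7 w q /\ snd (Cexp q) = 0.
Proof.
  assert (Hup : forall w : C, 1 / 2 <= snd w ->
            exists q, hyp_le 7 w q /\ snd (Cexp q) = 0).
  { clear w; intros [x y]; cbn [snd]; intros Hy.
    pose proof PI_RGT_0; pose proof PI_4; pose proof PI2_1.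
    destruct (nfloor_ex (y / PI)) as [k [Hk1 Hk2]].
    { apply Rdiv_le_0_compat; lra. }
    apply Rle_div_r in Hk1; [| lra]. apply Rlt_div_l in Hk2; [| lra].
    exists (x, INR (S k) * PI); split; [| apply snd_Cexp_mul_PI].
    rewrite S_INR.
    assert (HT : PI <= (INR k + 1) * PI) by (pose proof (pos_INR k); nra).
    assert (HT2 : (INR k + 1) * PI <= y + PI) by nra.
    set (T := (INR k + 1) * PI) in *.
    unfold hyp_le, sqdist; cbn [fst snd]; split; [nra |].
    assert (HyT : (y < PI /\ T = PI) \/ PI <= y).
    { destruct (Rlt_or_le y PI) as [Hlt | Hge]; [left; split; [exact Hlt |] | now right].
      destruct k as [| k]; [unfold T; simpl; ring |].
      rewrite S_INR in Hk1; pose proof (pos_INR k); nra. }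
    destruct HyT as [[Hlt ->] | Hge]; nra. }
  intros Hw; destruct (Rle_dec 0 (snd w)).
  - rewrite Rabs_pos_eq in Hw by lra; now apply Hup.
  - rewrite Rabs_left in Hw by lra.
    destruct (Hup (Cconj w)) as [q [H1 H2]]; [exact Hw |].
    exists (Cconj q); split.
    + rewrite <- (Cconj_conj w); now apply hyp_le_Cconj.
    + rewrite Cexp_Cconj; cbn [Cconj snd]; lra.
Qed.

Lemma exists_near_eventually_real (z : C) (r : R) :
  0 < r -> exists p n, sqdist z p < r /\ snd (iter n Cexp p) = 0.
Proof.
  intros Hr.
  destruct (classic (never_real z)) as [Hz | Hz].
  2: { apply not_all_ex_not in Hz; destruct Hz as [n Hn]; apply NNPP in Hn.
       exists z, n; split; [unfold sqdist; rewrite !Rminus_eq_0; lra | exact Hn]. }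
  set (y := snd z).
  assert (Hy : 0 < y ^ 2) by (apply pow2_gt_0, (Hz 0%nat)).
  (* The factor 63 is 7 times 9: the pulled-back point [p] satisfies [sqdist z p <= (108 / 109) ^ N
     * 7 * (y * snd p)], and [y * snd p <= 9 * y ^ 2]. *)
  destruct (pow_lt_1_zero (108 / 109) ltac:(rewrite Rabs_pos_eq; lra)
              (r / (63 * y ^ 2)) ltac:(apply Rdiv_lt_0_compat; lra)) as [N HN].
  specialize (HN N (Nat.le_refl N)).
  pose proof (pow_le (108 / 109) N ltac:(lra)) as HN0.
  pose proof (pow_incr (108 / 109) 1 N ltac:(lra)) as HN1; rewrite pow1 in HN1.
  rewrite Rabs_pos_eq in HN by exact HN0.
  apply Rlt_div_r in HN; [| lra].
  destruct (hyp_le_strong_pullback z N Hz) as [n [Hn Hpull]].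
  destruct (exists_hyp_close_to_preimage_of_reals _ Hn) as [q [Hq1 Hq2]].
  destruct (Hpull 7 q (Rle_refl _) Hq1) as [p [Hp1 [Hp2 Hp3]]].
  exists p, (S n); split; [| cbn [iter]; now rewrite Hp1].
  set (T := (108 / 109) ^ N) in *.
  fold y in Hp2, Hp3.
  assert (Hv : y * snd p <= 9 * y ^ 2).
  { assert (Hs : (y - snd p) ^ 2 <= 7 * (y * snd p)).
    { unfold sqdist in Hp3; fold y in Hp3.
      pose proof (pow2_ge_0 (fst z - fst p)); nra. }
    set (v := snd p) in *; clearbody T y v.
    destruct (Rlt_or_le 0 y); nra. }
  nra.
Qed.

(** * Inverse branches and repelling fixed points *)

Lemma sqdist_Cmod (z w : C) : sqdist z w = Cmod (z - w)%C ^ 2.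
Proof.
  unfold Cmod; rewrite <- (Rsqr_pow2 (sqrt _)), Rsqr_sqrt.
  - unfold sqdist; cbn; ring.
  - apply Rplus_le_le_0_compat; apply pow2_ge_0.
Qed.

Lemma Cmod_sub_comm (z w : C) : Cmod (z - w)%C = Cmod (w - z)%C.
Proof. rewrite <- (Cmod_opp (w - z)%C); f_equal; ring. Qed.

Lemma Cmod_sub_triangle (x y z : C) :
  Cmod (x - z)%C <= Cmod (x - y)%C + Cmod (y - z)%C.
Proof.
  replace (x - z)%C with ((x - y) + (y - z))%C by ring; apply Cmod_triangle.
Qed.

Lemma Cmod_le_add (z : C) : Cmod z <= Rabs (fst z) + Rabs (snd z).
Proof.
  replace z with (RtoC (fst z) + Ci * RtoC (snd z))%C at 1
    by (destruct z; cbn; unfold Cplus, Cmult; cbn; f_equal; ring).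
  eapply Rle_trans; [apply Cmod_triangle |].
  rewrite Cmod_mult, Cmod_Ci, !Cmod_R; lra.
Qed.

Lemma Rabs_fst_le_Cmod (z : C) : Rabs (fst z) <= Cmod z.
Proof. eapply Rle_trans; [apply Rmax_l | apply Rmax_Cmod]. Qed.

Lemma Rabs_snd_le_Cmod (z : C) : Rabs (snd z) <= Cmod z.
Proof. eapply Rle_trans; [apply Rmax_r | apply Rmax_Cmod]. Qed.

Lemma Cexp_add (z w : C) : Cexp (z + w)%C = (Cexp z * Cexp w)%C.
Proof.
  unfold Cexp, Cmult, Cplus; cbn [fst snd].
  rewrite exp_plus, cos_plus, sin_plus; f_equal; ring.
Qed.

Lemma Cmod_Cexp (z : C) : Cmod (Cexp z) = exp (fst z).
Proof.
  unfold Cmod, Cexp; cbn [fst snd].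
  pose proof (sin2_cos2 (snd z)) as H; unfold Rsqr in H.
  replace ((exp (fst z) * cos (snd z)) ^ 2 + (exp (fst z) * sin (snd z)) ^ 2)
    with (exp (fst z) ^ 2 * (sin (snd z) * sin (snd z) + cos (snd z) * cos (snd z)))
    by ring.
  rewrite H, Rmult_1_r; apply sqrt_pow2; left; apply exp_pos.
Qed.

Lemma Cexp_0 : Cexp (RtoC 0) = RtoC 1.
Proof.
  unfold Cexp, RtoC; cbn [fst snd]; rewrite exp_0, cos_0, sin_0; f_equal; ring.
Qed.

(* A branch of the inverse of the [n]-th iterate of [Cexp], defined on the closed
   disc of radius [r] around [b], mapping [b] to [a], with Lipschitz constant [L]. *)
Definition branch (n : nat) (a b : C) (r L : R) : Prop :=
  exists G : C -> C, G b = a /\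
    forall w w', Cmod (w - b)%C <= r -> Cmod (w' - b)%C <= r ->
      iter n Cexp (G w) = w /\ Cmod (G w - G w')%C <= L * Cmod (w - w')%C.

(** The quotient of [w] by [Cexp a] lies in the unit disc around 1, so it has positive real part.
    Multiplied by [Ci] it falls in the upper half plane, where [polar_upper] gives a logarithm; the
    rotation is undone by subtracting [PI / 2]. *)
Lemma local_log (a w : C) :
  Cmod (w - Cexp a)%C < Cmod (Cexp a) ->
  exists z, Cexp z = w /\ Rabs (snd z - snd a) < PI / 2.
Proof.
  intros Hw.
  assert (Hinv : (Cexp a * Cexp (- a) = 1)%C).
  { rewrite <- Cexp_add, Cplus_opp_r; apply Cexp_0. }
  set (k := (w * Cexp (- a))%C).
  assert (Hk : Cmod (k - 1)%C < 1).
  { replace (k - 1)%C with ((w - Cexp a) * Cexp (- a))%C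
      by (unfold k; rewrite <- Hinv; ring).
    rewrite Cmod_mult.
    assert (Hm : Cmod (Cexp a) * Cmod (Cexp (- a)%C) = 1)
      by (rewrite <- Cmod_mult, Hinv; apply Cmod_1).
    assert (0 < Cmod (Cexp (- a)%C)) by (rewrite Cmod_Cexp; apply exp_pos).
    rewrite <- Hm; now apply Rmult_lt_compat_r. }
  assert (Hre : 0 < fst k).
  { pose proof (Rabs_fst_le_Cmod (k - 1)%C) as H.
    assert (Hlt : Rabs (fst (k - 1)%C) < 1) by lra.
    apply Rabs_def2 in Hlt; change (fst (k - 1)%C) with (fst k - 1) in Hlt; lra. }
  destruct (polar_upper (Ci * k)%C) as [u [v [Hv Huv]]].
  { change (snd (Ci * k)%C) with (0 * snd k + 1 * fst k); lra. }
  exists (a + (u, (v - PI / 2)%R))%C; split.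
  - rewrite Cexp_add.
    replace (Cexp (u, v - PI / 2)) with (- Ci * Cexp (u, v))%C.
    + rewrite Huv; unfold k.
      change (@eq C (Cexp a * (- Ci * (Ci * (w * Cexp (- a)))))%C w).
      transitivity (- (Ci * Ci) * (Cexp a * Cexp (- a)) * w)%C; [ring |].
      rewrite Hinv; unfold Cmult, Copp, Ci; destruct w; cbn; f_equal; ring.
    + unfold Cexp, Cmult, Copp, Ci; cbn [fst snd].
      rewrite cos_minus, sin_minus, cos_PI2, sin_PI2; f_equal; ring.
  - cbn [Cplus fst snd]; apply Rabs_def1; lra.
Qed.

(** Any two logarithms chosen by [local_log] have imaginary parts less than [PI] apart, so
    [Cexp_expansion] applies. On the disc of radius [Cmod b / 2] the moduli are at least
    [Cmod b / 2], whence the constant [4 / Cmod b]. *)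
Lemma branch_log (a b : C) (r : R) :
  Cexp a = b -> r <= Cmod b / 2 -> branch 1 a b r (4 / Cmod b).
Proof.
  intros Eb Hr.
  assert (Hb : 0 < Cmod b) by (rewrite <- Eb, Cmod_Cexp; apply exp_pos).
  set (P := fun w z : C => Cexp z = w /\ Rabs (snd z - snd a) < PI / 2).
  set (G := fun w => epsilon (inhabits (RtoC 0)) (P w)).
  assert (HG : forall w, Cmod (w - b)%C <= Cmod b / 2 -> P w (G w)).
  { intros w Hw; unfold G; apply epsilon_spec; apply local_log; rewrite Eb; lra. }
  assert (Hlip : forall w w' z z', P w z -> P w' z' ->
    Cmod (w - b)%C <= Cmod b / 2 -> Cmod (w' - b)%C <= Cmod b / 2 ->
    Cmod (z - z')%C <= 4 / Cmod b * Cmod (w - w')%C).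
  { intros w w' z z' [E H] [E' H'] Hw Hw'.
    assert (Him : Rabs (snd z - snd z') <= PI).
    { apply Rabs_def2 in H; apply Rabs_def2 in H'; apply Rabs_le; lra. }
    pose proof (Cexp_expansion z z' Him) as He.
    rewrite exp_plus, <- !Cmod_Cexp, !sqdist_Cmod, E, E' in He.
    assert (Hm : forall x, Cmod (x - b)%C <= Cmod b / 2 -> Cmod b / 2 <= Cmod x).
    { intros x Hx; pose proof (Cmod_triangle x (b - x)%C) as Ht.
      replace (x + (b - x))%C with b in Ht by ring.
      rewrite (Cmod_sub_comm b x) in Ht; lra. }
    pose proof (Hm _ Hw); pose proof (Hm _ Hw').
    pose proof (Cmod_ge_0 (z - z')%C); pose proof (Cmod_ge_0 (w - w')%C).
    set (B := Cmod b) in *; set (d := Cmod (z - z')%C) in *.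
    set (e := Cmod (w - w')%C) in *.
    assert (Hsq : (B / 2 * d) ^ 2 <= (2 * e) ^ 2).
    { apply Rle_trans with (Cmod w * Cmod w' * d ^ 2); [| lra].
      replace ((B / 2 * d) ^ 2) with (B / 2 * (B / 2) * d ^ 2) by ring.
      apply Rmult_le_compat_r; [apply pow2_ge_0 |].
      apply Rmult_le_compat; lra. }
    assert (Hle : B / 2 * d <= 2 * e) by (apply Rsqr_incr_0_var; [unfold Rsqr; lra | lra]).
    apply (Rmult_le_reg_l (B / 2)); [lra |].
    replace (B / 2 * (4 / B * e)) with (2 * e) by (field; lra).
    exact Hle. }
  assert (Hbb : Cmod (b - b)%C <= Cmod b / 2).
  { replace (b - b)%C with (RtoC 0) by ring; rewrite Cmod_0; lra. }
  exists G; split.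
  (* [a] is also an admissible logarithm of [b], so the Lipschitz bound at distance 0 forces the
     chosen value [G b] to equal [a]. *)
  - assert (HPa : P b a).
    { split; [exact Eb |]; rewrite Rminus_eq_0, Rabs_R0; pose proof PI_RGT_0; lra. }
    pose proof (Hlip b b (G b) a (HG b Hbb) HPa Hbb Hbb) as H.
    replace (b - b)%C with (RtoC 0) in H by ring.
    rewrite Cmod_0, Rmult_0_r in H.
    assert (H0 : (G b - a = 0)%C) by (apply Cmod_eq_0, Rle_antisym; [exact H | apply Cmod_ge_0]).
    replace (G b) with ((G b - a) + a)%C by ring; rewrite H0; ring.
  - intros w w' Hw Hw'; split.
    + cbn; apply (HG w); lra.
    + apply Hlip; try apply HG; lra.
Qed.

Lemma branch_weaken (n : nat) (a b : C) (r L r' L' : R) :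
  branch n a b r L -> r' <= r -> L <= L' -> branch n a b r' L'.
Proof.
  intros [G [Hb HG]] Hr HL; exists G; split; [exact Hb |].
  intros w w' Hw Hw'.
  destruct (HG w w' ltac:(lra) ltac:(lra)) as [H1 H2]; split; [exact H1 |].
  pose proof (Cmod_ge_0 (w - w')%C); nra.
Qed.

Lemma Cmod_sub_self (b : C) : Cmod (b - b)%C = 0.
Proof. replace (b - b)%C with (RtoC 0) by ring; apply Cmod_0. Qed.

Lemma branch_comp (n m : nat) (a b c : C) (r L r' L' : R) :
  0 <= r' -> 0 <= L -> 0 <= L' -> L' * r' <= r ->
  branch n a b r L -> branch m b c r' L' -> branch (m + n) a c r' (L * L').
Proof.
  intros Hr' HL HL' Hr [G [Gb HG]] [H [Hc HH]].
  exists (fun w => G (H w)); split; [now rewrite Hc |].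
  assert (Hin : forall w, Cmod (w - c)%C <= r' -> Cmod (H w - b)%C <= r).
  { intros w Hw; rewrite <- Hc.
    destruct (HH w c Hw) as [_ Hl]; [rewrite Cmod_sub_self; lra |].
    nra. }
  intros w w' Hw Hw'.
  destruct (HH w w' Hw Hw') as [E1 L1].
  destruct (HG (H w) (H w') (Hin w Hw) (Hin w' Hw')) as [E2 L2].
  split; [now rewrite iter_add, E2, E1 |].
  nra.
Qed.

Lemma branch_recenter (n : nat) (a b b' : C) (r r' L : R) :
  0 <= r' -> branch n a b r L -> Cmod (b' - b)%C <= r - r' ->
  exists a', Cmod (a' - a)%C <= L * Cmod (b' - b)%C /\ branch n a' b' r' L.
Proof.
  intros Hr' [G [Gb HG]] Hb'.
  pose proof (Cmod_ge_0 (b' - b)%C).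
  exists (G b'); split.
  - rewrite <- Gb; apply HG; [lra | rewrite Cmod_sub_self; lra].
  - exists G; split; [reflexivity |].
    intros w w' Hw Hw'; apply HG.
    + pose proof (Cmod_sub_triangle w b' b); lra.
    + pose proof (Cmod_sub_triangle w' b' b); lra.
Qed.

Lemma branch_iter (a : C) (n : nat) :
  exists r L, 0 < r /\ 0 < L /\ branch n a (iter n Cexp a) r L.
Proof.
  induction n as [| n [r [L [Hr [HL IH]]]]].
  - exists 1, 1; split; [lra | split; [lra |]].
    exists (fun w => w); split; [reflexivity |].
    intros w w' _ _; split; [reflexivity | lra].
  - cbn [iter]; set (b := iter n Cexp a) in *.
    assert (Hb : 0 < Cmod (Cexp b)) by (rewrite Cmod_Cexp; apply exp_pos).
    set (B := Cmod (Cexp b)) in *.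
    assert (Hinv : 0 < 4 / B) by (apply Rdiv_lt_0_compat; lra).
    exists (Rmin (B / 2) (r / (4 / B))), (L * (4 / B)).
    assert (Hrb : 0 < r / (4 / B)) by (now apply Rdiv_lt_0_compat).
    assert (Hm : 0 < Rmin (B / 2) (r / (4 / B))) by (apply Rmin_glb_lt; lra).
    split; [exact Hm | split; [now apply Rmult_lt_0_compat |]].
    apply (branch_comp n 1 a b (Cexp b) r L); try lra.
    + rewrite Rmult_comm; apply Rle_div_r; [exact Hinv | apply Rmin_r].
    + exact IH.
    + apply branch_log; [reflexivity | apply Rmin_l].
Qed.

(** * Geometric convergence and the contraction principle *)

Lemma le_of_le_add_geometric (x y D : R) :
  (forall k, x <= y + D * (1 / 2) ^ k) -> x <= y.
Proof.
  intros H; apply Rnot_lt_le; intros Hlt.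
  assert (HD : 0 < D) by (pose proof (H 0%nat) as H0; simpl in H0; lra).
  destruct (pow_lt_1_zero (1 / 2) ltac:(rewrite Rabs_pos_eq; lra) ((x - y) / D)
     ltac:(apply Rdiv_lt_0_compat; lra)) as [N HN].
  specialize (HN N (Nat.le_refl N)); specialize (H N).
  rewrite Rabs_pos_eq in HN by (apply pow_le; lra).
  apply Rlt_div_r in HN; lra.
Qed.

(** [x k - 2 d / 2^k] increases, [x k + 2 d / 2^k] decreases, and the former stays below the latter.
    The supremum of the lower sequence is the limit; [B] is negated so that both sequences grow. *)
Lemma real_geometric_limit (x : nat -> R) (d : R) :
  (forall k, Rabs (x (S k) - x k) <= d * (1 / 2) ^ k) ->
  exists l, forall k, Rabs (l - x k) <= 2 * d * (1 / 2) ^ k.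
Proof.
  intros H.
  set (A := fun k => x k - 2 * d * (1 / 2) ^ k).
  set (B := fun k => - (x k + 2 * d * (1 / 2) ^ k)).
  assert (Hd : 0 <= d).
  { pose proof (H 0%nat) as H0; pose proof (Rabs_pos (x 1%nat - x 0%nat)).
    simpl in H0; lra. }
  assert (HA : Un_growing A).
  { intros k; unfold A; pose proof (H k) as Hk; apply Rabs_le_between in Hk.
    cbn [pow]; lra. }
  assert (HB : Un_growing B).
  { intros k; unfold B; pose proof (H k) as Hk; apply Rabs_le_between in Hk.
    cbn [pow]; lra. }
  assert (HAB : forall k m, A k <= - B m).
  { intros k m.
    pose proof (growing_prop A _ _ HA (Nat.le_max_l k m)).
    pose proof (growing_prop B _ _ HB (Nat.le_max_r k m)).
    set (M := Nat.max k m) in *.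
    assert (A M <= - B M).
    { unfold A, B; pose proof (pow_le (1 / 2) M ltac:(lra)).
      assert (0 <= d * (1 / 2) ^ M) by (now apply Rmult_le_pos). lra. }
    lra. }
  destruct (completeness (fun y => exists k, y = A k)) as [l [Hub Hlub]].
  - exists (- B 0%nat); intros y [k ->]; apply HAB.
  - now exists (A 0%nat), 0%nat.
  - exists l; intros k; apply Rabs_le_between.
    assert (A k <= l) by (apply Hub; now exists k).
    assert (l <= - B k) by (apply Hlub; intros y [m ->]; apply HAB).
    unfold A, B in *; lra.
Qed.

Lemma complex_geometric_limit (x : nat -> C) (d : R) :
  (forall k, Cmod (x (S k) - x k)%C <= d * (1 / 2) ^ k) ->
  exists l, forall k, Cmod (l - x k)%C <= 4 * d * (1 / 2) ^ k.
Proof.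
  intros H.
  destruct (real_geometric_limit (fun k => fst (x k)) d) as [l1 H1].
  { intros k; eapply Rle_trans; [| apply (H k)].
    apply (Rabs_fst_le_Cmod (x (S k) - x k)%C). }
  destruct (real_geometric_limit (fun k => snd (x k)) d) as [l2 H2].
  { intros k; eapply Rle_trans; [| apply (H k)].
    apply (Rabs_snd_le_Cmod (x (S k) - x k)%C). }
  exists (l1, l2); intros k.
  eapply Rle_trans; [apply Cmod_le_add |].
  specialize (H1 k); specialize (H2 k); cbn in *; unfold Rminus in *; lra.
Qed.

Lemma contraction_fixed_point (G : C -> C) (z : C) (r : R) :
  0 <= r ->
  (forall w, Cmod (w - z)%C <= r -> Cmod (G w - z)%C <= r) ->
  (forall w w', Cmod (w - z)%C <= r -> Cmod (w' - z)%C <= r ->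
    Cmod (G w - G w')%C <= 1 / 2 * Cmod (w - w')%C) ->
  exists p, Cmod (p - z)%C <= r /\ G p = p.
Proof.
  intros Hr Hmap Hlip.
  set (x := fun k => Nat.iter k G z).
  assert (Hx : forall k, Cmod (x k - z)%C <= r).
  { induction k as [| k IH]; [unfold x; cbn; rewrite Cmod_sub_self; lra |].
    now apply Hmap. }
  set (d := Cmod (x 1%nat - x 0%nat)%C).
  destruct (complex_geometric_limit x d) as [p Hp].
  { induction k as [| k IH]; [simpl pow; rewrite Rmult_1_r; apply Rle_refl |].
    change (Cmod (G (x (S k)) - G (x k))%C <= d * (1 / 2) ^ S k).
    pose proof (Hlip _ _ (Hx (S k)) (Hx k)); cbn [pow]; lra. }
  assert (Hpz : Cmod (p - z)%C <= r).
  { apply le_of_le_add_geometric with (4 * d); intros k.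
    pose proof (Cmod_sub_triangle p (x k) z); pose proof (Hx k); pose proof (Hp k); lra. }
  exists p; split; [exact Hpz |].
  assert (H0 : Cmod (G p - p)%C <= 0).
  { apply le_of_le_add_geometric with (4 * d); intros k.
    pose proof (Cmod_sub_triangle (G p) (x (S k)) p).
    pose proof (Hlip p (x k) Hpz (Hx k)) as H1; change (G (x k)) with (x (S k)) in H1.
    pose proof (Hp k); pose proof (Hp (S k)) as H2.
    rewrite Cmod_sub_comm in H2; cbn [pow] in H2; lra. }
  assert (E : (G p - p = 0)%C)
    by (apply Cmod_eq_0, Rle_antisym; [exact H0 | apply Cmod_ge_0]).
  replace (G p) with ((G p - p) + p)%C by ring; rewrite E; ring.
Qed.

(** * Complex derivatives and repelling fixed points *)

Lemma has_cderiv_comp (g h : C -> C) (p L M : C) :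
  has_cderiv g p L -> has_cderiv h (g p) M ->
  has_cderiv (fun z => h (g z)) p (Cmult M L).
Proof.
  intros Hg Hh eps Heps.
  pose proof (Cmod_ge_0 L) as HL; pose proof (Cmod_ge_0 M) as HM.
  set (e1 := eps / (2 * (Cmod L + 1))).
  assert (He1 : 0 < e1) by (apply Rdiv_lt_0_compat; lra).
  set (e2 := Rmin 1 (eps / (2 * (Cmod M + 1)))).
  assert (He2 : 0 < e2) by (apply Rmin_glb_lt; [lra | apply Rdiv_lt_0_compat; lra]).
  assert (He2' : e2 <= 1) by apply Rmin_l.
  assert (He2M : e2 * (2 * (Cmod M + 1)) <= eps)
    by (apply Rle_div_r; [lra | apply Rmin_r]).
  assert (He1L : e1 * (2 * (Cmod L + 1)) = eps) by (unfold e1; field; lra).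
  destruct (Hh e1 He1) as [d1 [Hd1 Hh1]].
  destruct (Hg e2 He2) as [d2 [Hd2 Hg1]].
  exists (Rmin d2 (d1 / (Cmod L + 1))); split.
  { apply Rmin_glb_lt; [lra | apply Rdiv_lt_0_compat; lra]. }
  intros k Hk0 Hk.
  change (0 < Cmod k) in Hk0. change (Cmod k < Rmin d2 (d1 / (Cmod L + 1))) in Hk.
  assert (Hk2 : Cmod k < d2) by (eapply Rlt_le_trans; [exact Hk | apply Rmin_l]).
  assert (Hk1 : Cmod k * (Cmod L + 1) < d1).
  { apply Rlt_div_r; [lra |]; eapply Rlt_le_trans; [exact Hk | apply Rmin_r]. }
  specialize (Hg1 k Hk0 Hk2).
  set (u := (g (p + k) - g p)%C).
  change (Cmod (u - L * k)%C <= e2 * Cmod k) in Hg1.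
  assert (Hu : Cmod u <= (Cmod L + 1) * Cmod k).
  { replace u with ((u - L * k) + L * k)%C by ring.
    eapply Rle_trans; [apply Cmod_triangle |]; rewrite Cmod_mult; nra. }
  assert (Hhu : Cmod (h (g p + u) - h (g p) - M * u)%C <= e1 * Cmod u).
  (* [has_cderiv] says nothing about a zero increment, and [u] may vanish even though [k] does
     not. *)
  { destruct (Rle_lt_or_eq_dec 0 (Cmod u) (Cmod_ge_0 u)) as [Hu0 | Hu0].
    - apply (Hh1 u Hu0); change (Cmod u < d1); lra.
    - symmetry in Hu0; rewrite Hu0; apply Cmod_eq_0 in Hu0; rewrite Hu0.
      replace (g p + 0)%C with (g p) by ring.
      replace (h (g p) - h (g p) - M * 0)%C with (RtoC 0) by ring.
      rewrite Cmod_0; lra. }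
  change (Cmod (h (g (p + k)%C) - h (g p) - M * L * k)%C <= eps * Cmod k).
  replace (g (p + k)%C) with (g p + u)%C by (unfold u; ring).
  replace (h (g p + u) - h (g p) - M * L * k)%C
    with ((h (g p + u) - h (g p) - M * u) + M * (u - L * k))%C by ring.
  eapply Rle_trans; [apply Cmod_triangle |]; rewrite Cmod_mult.
  assert (e1 * Cmod u <= eps / 2 * Cmod k) by nra.
  assert (Cmod M * Cmod (u - L * k)%C <= eps / 2 * Cmod k) by nra.
  lra.
Qed.

Lemma Cexp_second_order (h : C) :
  Cmod h <= 1 / 2 -> Cmod (Cexp h - 1 - h)%C <= 4 * Cmod h ^ 2.
Proof.
  intros Hh.
  pose proof (Rabs_fst_le_Cmod h) as Ha; pose proof (Rabs_snd_le_Cmod h) as Hb.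
  assert (Hm : Cmod h ^ 2 = fst h ^ 2 + snd h ^ 2).
  { pose proof (sqdist_Cmod h 0) as E; unfold sqdist in E; cbn [fst snd RtoC] in E.
    replace (h - 0)%C with h in E by ring; rewrite <- E; ring. }
  destruct h as [a b]; cbn [fst snd] in *.
  eapply Rle_trans; [apply Cmod_le_add |]; rewrite Hm; clear Hm.
  assert (Ha2 : Rabs a <= 1 / 2) by lra; assert (Hb2 : Rabs b <= 1 / 2) by lra.
  clear Ha Hb Hh.
  apply Rabs_le_between in Ha2; apply Rabs_le_between in Hb2.
  unfold Cexp; cbn [fst snd Cminus Cplus Copp RtoC].
  assert (HA : 0 <= exp a - 1 - a <= 2 * a ^ 2).
  { pose proof (exp_ineq1_le a); pose proof (exp_ineq1_le (- a)).
    assert (exp a * exp (- a) = 1) by (rewrite <- exp_plus, Rplus_opp_r; apply exp_0).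
    pose proof (exp_pos a).
    split; [lra |].
    assert (exp a * (1 - a) <= 1) by nra.
    assert (1 <= (1 + a + 2 * a ^ 2) * (1 - a)) by nra.
    nra. }
  assert (Hpos : forall t, 0 <= t <= 1 / 2 ->
            0 <= 1 - cos t <= t ^ 2 / 2 /\ 0 <= t - sin t <= t ^ 2).
  { intros t Ht; pose proof PI2_1.
    assert (Hc : 1 - cos t <= t ^ 2 / 2).
    { replace (cos t) with (cos (2 * (t / 2))) by (f_equal; lra).
      rewrite cos_2a_sin.
      pose proof (sin_le_self (t / 2) ltac:(lra)).
      pose proof (sin_ge_0 (t / 2) ltac:(lra) ltac:(lra)); nra. }
    pose proof (COS_bound t); pose proof (sin_le_self t ltac:(lra)).
    pose proof (mul_cos_le_sin t ltac:(lra)).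
    repeat split; try lra; nra. }
  assert (HB : 0 <= 1 - cos b <= b ^ 2 / 2 /\ Rabs (b - sin b) <= b ^ 2).
  { destruct (Rle_dec 0 b).
    - destruct (Hpos b ltac:(lra)) as [H1 H2]; split; [exact H1 |].
      apply Rabs_le_between; lra.
    - destruct (Hpos (- b) ltac:(lra)) as [H1 H2]; rewrite cos_neg, sin_neg in *.
      split; [nra |]; apply Rabs_le_between; nra. }
  destruct HB as [Hc Hs]; apply Rabs_le_between in Hs.
  (* With the Taylor remainders [A], [c], [s] as variables, only polynomial inequalities remain. *)
  set (A := exp a - 1 - a) in *; replace (exp a) with (1 + a + A) by (unfold A; ring).
  set (c := 1 - cos b) in *; replace (cos b) with (1 - c) by (unfold c; ring).
  set (s := b - sin b) in *; replace (sin b) with (b - s) by (unfold s; ring).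
  clearbody A c s.
  assert (HA1 : 1 + a + A <= 2) by nra.
  assert (HA0 : 0 <= 1 + a + A) by lra.
  assert (H1 : Rabs ((1 + a + A) * (1 - c) + - (1) + - a) <= 2 * a ^ 2 + b ^ 2).
  { replace ((1 + a + A) * (1 - c) + - (1) + - a) with (A - (1 + a + A) * c) by ring.
    assert (0 <= (1 + a + A) * c <= 2 * c) by nra.
    apply Rabs_le_between; nra. }
  assert (H2 : Rabs ((1 + a + A) * (b - s) + - 0 + - b) <= 3 / 2 * a ^ 2 + 5 / 2 * b ^ 2).
  { replace ((1 + a + A) * (b - s) + - 0 + - b) with (a * b + A * b - (1 + a + A) * s) by ring.
    assert (- (2 * b ^ 2) <= (1 + a + A) * s <= 2 * b ^ 2) by nra.
    assert (- (a ^ 2) <= A * b <= a ^ 2) by nra.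
    pose proof (pow2_ge_0 (a - b)); pose proof (pow2_ge_0 (a + b)).
    apply Rabs_le_between; nra. }
  nra.
Qed.

Lemma has_cderiv_Cexp (p : C) : has_cderiv Cexp p (Cexp p).
Proof.
  intros eps Heps.
  assert (Hp : 0 < Cmod (Cexp p)) by (rewrite Cmod_Cexp; apply exp_pos).
  exists (Rmin (1 / 2) (eps / (4 * Cmod (Cexp p)))); split.
  { apply Rmin_glb_lt; [lra | apply Rdiv_lt_0_compat; lra]. }
  intros h Hh0 Hh.
  change (0 < Cmod h) in Hh0.
  change (Cmod h < Rmin (1 / 2) (eps / (4 * Cmod (Cexp p)))) in Hh.
  change (Cmod (Cexp (p + h)%C - Cexp p - Cexp p * h)%C <= eps * Cmod h).
  assert (Hh1 : Cmod h < 1 / 2) by (eapply Rlt_le_trans; [exact Hh | apply Rmin_l]).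
  assert (Hh2 : Cmod h * (4 * Cmod (Cexp p)) < eps).
  { apply Rlt_div_r; [lra |]; eapply Rlt_le_trans; [exact Hh | apply Rmin_r]. }
  rewrite Cexp_add.
  replace (Cexp p * Cexp h - Cexp p - Cexp p * h)%C
    with (Cexp p * (Cexp h - 1 - h))%C by ring.
  rewrite Cmod_mult.
  pose proof (Cexp_second_order h ltac:(lra)); nra.
Qed.

Lemma has_cderiv_iter_Cexp (n : nat) (p : C) :
  exists L, has_cderiv (iter n Cexp) p L.
Proof.
  induction n as [| n [L IH]].
  - exists (RtoC 1); intros eps Heps; exists 1; split; [lra |].
    intros h _ _.
    change (Cmod (p + h - p - 1 * h)%C <= eps * Cmod h).
    replace (p + h - p - 1 * h)%C with (RtoC 0) by ring.
    rewrite Cmod_0; pose proof (Cmod_ge_0 h); nra.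
  - eexists; exact (has_cderiv_comp _ _ _ _ _ IH (has_cderiv_Cexp _)).
Qed.

(** The branch sends the disc into the one of radius [r / 2 + r / 4], so it has a fixed point [p].
    The iterate inverts a map with Lipschitz constant [1 / 2], hence expands near [p]. *)
Lemma branch_repelling (n : nat) (s z : C) (r : R) :
  (1 <= n)%nat -> 0 < r -> Cmod (s - z)%C <= r / 4 -> branch n s z r (1 / 2) ->
  exists p, Cmod (p - z)%C <= r /\ repelling_periodic_point Cexp p.
Proof.
  intros Hn Hr Hs [G [Gz HG]].
  assert (Hzz : Cmod (z - z)%C <= r) by (rewrite Cmod_sub_self; lra).
  assert (Hmap : forall w, Cmod (w - z)%C <= r -> Cmod (G w - z)%C <= 3 / 4 * r).
  { intros w Hw; pose proof (Cmod_sub_triangle (G w) s z).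
    destruct (HG w z Hw Hzz) as [_ H1]; rewrite Gz in H1; lra. }
  destruct (contraction_fixed_point G z r) as [p [Hp Gp]].
  - lra.
  - intros w Hw; pose proof (Hmap w Hw); lra.
  - intros w w' Hw Hw'; now apply HG.
  - assert (Hfix : iter n Cexp p = p).
    { rewrite <- Gp at 1; now apply (HG p p). }
    exists p; split; [exact Hp |].
    destruct (has_cderiv_iter_Cexp n p) as [L HL].
    exists n; split; [exact Hn | split; [exact Hfix |]].
    exists L; split; [exact HL |].
    change (Cmod L > 1).
    (* The derivative is tested on the increment [h = G w - p] with [w = p + t]: then
       [t <= (Cmod L + 1 / 2) * Cmod h] and [Cmod h <= t / 2], so [Cmod L >= 3 / 2]. *)
    destruct (HL (1 / 2) ltac:(lra)) as [d [Hd HLd]].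
    set (t := Rmin (r / 4) d).
    assert (Ht : 0 < t) by (apply Rmin_glb_lt; lra).
    assert (Htr : t <= r / 4) by apply Rmin_l.
    assert (Htd : t <= d) by apply Rmin_r.
    set (w := (p + RtoC t)%C).
    assert (Hwp : Cmod (w - p)%C = t).
    { replace (w - p)%C with (RtoC t) by (unfold w; ring).
      rewrite Cmod_R; apply Rabs_pos_eq; lra. }
    assert (Hwz : Cmod (w - z)%C <= r).
    { pose proof (Cmod_sub_triangle w p z); pose proof (Hmap p Hp) as H1.
      rewrite Gp in H1; lra. }
    destruct (HG w p Hwz Hp) as [Ew Lw]; rewrite Gp, Hwp in Lw.
    set (h := (G w - p)%C) in *.
    assert (EGw : G w = (p + h)%C) by (unfold h; ring).
    assert (Hh0 : 0 < Cmod h).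
    { apply Cmod_gt_0; intros E.
      rewrite EGw, E in Ew; replace (p + 0)%C with p in Ew by ring.
      rewrite Hfix in Ew; rewrite <- Ew, Cmod_sub_self in Hwp; lra. }
    specialize (HLd h Hh0 ltac:(change (Cmod h < d); lra)).
    change (Cmod (iter n Cexp (p + h)%C - iter n Cexp p - L * h)%C
            <= 1 / 2 * Cmod h) in HLd.
    rewrite <- EGw, Ew, Hfix in HLd.
    pose proof (Cmod_triangle (w - p - L * h)%C (L * h)%C) as Htri.
    replace (w - p - L * h + L * h)%C with (w - p)%C in Htri by ring.
    rewrite Hwp, Cmod_mult in Htri.
    pose proof (Cmod_ge_0 L); nra.
Qed.

(** * The return map *)

Lemma real_orbit (x : C) (k : nat) :
  snd x = 0 ->
  snd (iter k Cexp x) = 0 /\ fst x + INR k <= fst (iter k Cexp x).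
Proof.
  intros Hx; induction k as [| k [IH1 IH2]]; [simpl; lra |].
  cbn [iter]; unfold Cexp at 1 3; cbn [fst snd].
  rewrite IH1, sin_0, cos_0, S_INR.
  pose proof (exp_ineq1_le (fst (iter k Cexp x))); lra.
Qed.

(** Later orbit points have modulus at least 40, so each logarithm is defined on a disc of radius 20
    with constant [4 / 40], and sends the disc of radius 10 into one of radius 1. *)
Lemma branch_real_orbit (w : C) (m : nat) :
  snd w = 0 -> 40 <= fst w -> branch m w (iter m Cexp w) 10 ((1 / 10) ^ m).
Proof.
  intros Hw Hw40; induction m as [| m IH].
  - exists (fun z => z); split; [reflexivity |].
    intros z z' _ _; split; [reflexivity | simpl; lra].
  - cbn [iter]; destruct (real_orbit w m Hw) as [_ Hb].
    pose proof (pos_INR m); set (b := iter m Cexp w) in *.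
    assert (HB : 40 <= Cmod (Cexp b)).
    { rewrite Cmod_Cexp; pose proof (exp_ineq1_le (fst b)); lra. }
    replace ((1 / 10) ^ S m) with ((1 / 10) ^ m * (1 / 10)) by (simpl; ring).
    apply (branch_comp m 1 w b (Cexp b) 10); try lra.
    + apply pow_le; lra.
    + exact IH.
    + apply branch_weaken with (Cmod (Cexp b) / 2) (4 / Cmod (Cexp b)).
      * apply branch_log; [reflexivity | lra].
      * lra.
      * apply Rle_div_l; lra.
Qed.

Lemma exists_log (z : C) : z <> RtoC 0 -> exists l1 l2, Cexp (l1, l2) = z.
Proof.
  destruct z as [x y]; intros Hz.
  destruct (Rtotal_order y 0) as [Hy | [-> | Hy]].
  - destruct (polar_upper (- x, - y)) as [u [v [_ E]]]; [cbn; lra |].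
    exists u, (v + INR 1 * PI); rewrite Cexp_shift, E; cbn; f_equal; ring.
  - destruct (Rtotal_order x 0) as [Hx | [-> | Hx]].
    + exists (ln (- x)), PI; unfold Cexp; cbn [fst snd].
      rewrite cos_PI, sin_PI, exp_ln by lra; f_equal; ring.
    + now contradict Hz.
    + exists (ln x), 0; unfold Cexp; cbn [fst snd].
      rewrite cos_0, sin_0, exp_ln by lra; f_equal; ring.
  - destruct (polar_upper (x, y)) as [u [v [_ E]]]; [cbn; lra |].
    now exists u, v.
Qed.

(* The second preimage is [Log (log z + 2 k PI i)] with [2 k PI] close to [exp X]. *)
Lemma branch_return (z : C) :
  z <> RtoC 0 ->
  exists A, forall X, A <= X ->
    exists t, Cmod (t - RtoC X)%C <= 5 /\ branch 2 t z (Cmod z / 2) (4 / Cmod z).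
Proof.
  intros Hz.
  assert (Hm : 0 < Cmod z) by (now apply Cmod_gt_0).
  destruct (exists_log z Hz) as [l1 [l2 El]].
  exists (Rabs l1 + Rabs l2 + 8); intros X HX.
  pose proof (Rabs_pos l1); pose proof (Rabs_pos l2); pose proof (Rle_abs l2).
  pose proof PI_RGT_0; pose proof PI_4.
  pose proof (exp_ineq1_le X) as HeX.
  destruct (nfloor_ex ((exp X - l2) / (2 * PI))) as [k [Hk1 Hk2]].
  { apply Rdiv_le_0_compat; lra. }
  apply Rle_div_r in Hk1; [| lra]. apply Rlt_div_l in Hk2; [| lra].
  (* The even multiple of [PI] keeps the sign in [Cexp_shift] positive; the successor puts [T] above
     [exp X], by at most [2 * PI <= 8]. *)
  set (T := l2 + INR (2 * S k) * PI).
  assert (HT : exp X <= T <= exp X + 8).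
  { unfold T; rewrite mult_INR, (S_INR k); simpl (INR 2); lra. }
  assert (Et1 : Cexp (l1, T) = z).
  { unfold T; rewrite Cexp_shift, El, pow_1_even.
    destruct z as [z1 z2]; cbn [fst snd]; f_equal; ring. }
  set (t1 := (l1, T) : C) in *.
  assert (Ht1 : exp X <= Cmod t1 <= 2 * exp X).
  { pose proof (Rabs_snd_le_Cmod t1) as Hlow; pose proof (Cmod_le_add t1) as Hup.
    unfold t1 in Hlow at 1; unfold t1 in Hup at 2 3; cbn [fst snd] in Hlow, Hup.
    rewrite (Rabs_pos_eq T) in Hlow, Hup by lra; lra. }
  destruct (polar_upper t1) as [u [v [Hv Eu]]]; [cbn; lra |].
  exists ((u, v) : C); split.
  - rewrite <- Eu, Cmod_Cexp in Ht1; cbn [fst] in Ht1.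
    (* [exp u] lies between [exp X] and [2 * exp X], and [exp 1 >= 2]. With [0 < v < PI <= 4] this
       gives the distance bound 5. *)
    assert (Hu : X <= u <= X + 1).
    { split; apply Rnot_lt_le; intros Hlt; apply exp_increasing in Hlt; [lra |].
      rewrite exp_plus in Hlt; pose proof (exp_ineq1_le 1); pose proof (exp_pos X); nra. }
    eapply Rle_trans; [apply Cmod_le_add |].
    cbn [fst snd Cminus Cplus Copp RtoC].
    rewrite !Rabs_pos_eq by lra; lra.
  - apply branch_weaken with (Cmod z / 2) (4 / Cmod t1 * (4 / Cmod z)); [| lra |].
    + assert (0 < 4 / Cmod z) by (apply Rdiv_lt_0_compat; lra).
      assert (0 < 4 / Cmod t1) by (apply Rdiv_lt_0_compat; lra).
      apply (branch_comp 1 1 _ t1 z (Cmod t1 / 2)); try lra.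
      * replace (4 / Cmod z * (Cmod z / 2)) with 2 by (field; lra); lra.
      * apply branch_log; [exact Eu | lra].
      * apply branch_log; [exact Et1 | lra].
    + assert (4 / Cmod t1 <= 1) by (apply Rle_div_l; lra).
      assert (0 < 4 / Cmod z) by (apply Rdiv_lt_0_compat; lra).
      nra.
Qed.

Lemma repelling_near_eventually_real (z : C) (n : nat) (r : R) :
  z <> RtoC 0 -> snd (iter n Cexp z) = 0 -> 0 < r ->
  exists p, Cmod (p - z)%C <= r /\ repelling_periodic_point Cexp p.
Proof.
  intros Hz Hreal Hr.
  assert (Hm : 0 < Cmod z) by (now apply Cmod_gt_0).
  set (rho := Rmin r (Cmod z / 2)).
  assert (Hrho : 0 < rho) by (apply Rmin_glb_lt; lra).
  assert (Hrho1 : rho <= r) by apply Rmin_l.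
  assert (Hrho2 : rho <= Cmod z / 2) by apply Rmin_r.
  (* [Cmod z / 8] makes the loop constant [eps * (4 / Cmod z)] at most [1 / 2]; [rho / 20] makes the
     displacement [5 * eps] of [s] from [z] at most [rho / 4]. *)
  set (eps := Rmin (Cmod z / 8) (rho / 20)).
  assert (Heps : 0 < eps) by (apply Rmin_glb_lt; lra).
  assert (Heps1 : eps <= Cmod z / 8) by apply Rmin_l.
  assert (Heps2 : eps <= rho / 20) by apply Rmin_r.
  destruct (branch_return z Hz) as [A HA].
  destruct (nfloor_ex (Rabs (40 - fst (iter n Cexp z)))) as [M [_ HM]];
    [apply Rabs_pos |].
  destruct (real_orbit _ (S M) Hreal) as [Hw0 Hw1].
  rewrite <- iter_add in Hw0, Hw1.
  destruct (branch_iter z (S M + n)) as [r0 [L [Hr0 [HL Hbr]]]].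
  set (w := iter (S M + n) Cexp z) in *.
  assert (Hw40 : 40 <= fst w).
  { rewrite S_INR in Hw1; pose proof (Rle_abs (40 - fst (iter n Cexp z))); lra. }
  (* The contraction along the real axis must absorb the constant [L] of the initial stretch and
     shrink the disc of radius 10 into its domain of radius [r0]. *)
  set (d := Rmin (eps / L) (r0 / 10)).
  assert (Hd : 0 < d) by (apply Rmin_glb_lt; apply Rdiv_lt_0_compat; lra).
  destruct (pow_lt_1_zero (1 / 10) ltac:(rewrite Rabs_pos_eq; lra) d Hd) as [N HN].
  destruct (nfloor_ex (Rabs A)) as [K [_ HK]]; [apply Rabs_pos |].
  (* [N] steps provide the contraction; [S K] more push the real orbit past the threshold [A] of the
     return map. *)
  set (m := (N + S K)%nat).
  specialize (HN m ltac:(unfold m; lia)).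
  pose proof (pow_le (1 / 10) m ltac:(lra)) as Hq0.
  rewrite Rabs_pos_eq in HN by exact Hq0.
  assert (HqL : (1 / 10) ^ m * L <= eps).
  { apply Rle_div_r; [lra |]; pose proof (Rmin_l (eps / L) (r0 / 10)); unfold d in *; lra. }
  assert (Hqr : (1 / 10) ^ m * 10 <= r0).
  { apply Rle_div_r; [lra |]; pose proof (Rmin_r (eps / L) (r0 / 10)); unfold d in *; lra. }
  pose proof (branch_comp _ _ z w _ r0 L 10 _ ltac:(lra) ltac:(lra) Hq0 Hqr Hbr
    (branch_real_orbit w m Hw0 Hw40)) as Hbig.
  destruct (real_orbit w m Hw0) as [Hb0 Hb1].
  set (b := iter m Cexp w) in *.
  assert (HAb : A <= fst b).
  { unfold m in Hb1; rewrite plus_INR, S_INR in Hb1; pose proof (pos_INR N).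
    pose proof (Rle_abs A); lra. }
  assert (Eb : b = RtoC (fst b)).
  { destruct b as [b1 b2]; cbn [fst snd] in *; now rewrite Hb0. }
  destruct (HA (fst b) HAb) as [t [Ht Hret]]; rewrite <- Eb in Ht.
  apply (branch_weaken _ _ _ _ _ 10 eps) in Hbig; [| lra | lra].
  (* As [t] is within 5 of [b], the disc of radius 5 around [t] fits in the disc of radius 10 around
     [b]. *)
  destruct (branch_recenter _ _ _ t _ 5 _ ltac:(lra) Hbig ltac:(lra)) as [s [Hs Hbs]].
  apply (branch_weaken _ _ _ _ _ rho (4 / Cmod z)) in Hret; [| lra | lra].
  assert (Hz4 : 0 < 4 / Cmod z) by (apply Rdiv_lt_0_compat; lra).
  assert (Hz4r : 4 / Cmod z * rho <= 5).
  { apply Rle_trans with (4 / Cmod z * (Cmod z / 2)).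
    - apply Rmult_le_compat_l; lra.
    - replace (4 / Cmod z * (Cmod z / 2)) with 2 by (field; lra); lra. }
  pose proof (branch_comp _ _ s t z 5 eps rho (4 / Cmod z) ltac:(lra) ltac:(lra) ltac:(lra)
    Hz4r Hbs Hret) as Hloop.
  apply (branch_weaken _ _ _ _ _ rho (1 / 2)) in Hloop; [| lra |].
  2: { apply Rle_trans with (Cmod z / 8 * (4 / Cmod z)).
       - apply Rmult_le_compat_r; lra.
       - right; field; lra. }
  assert (Hsz : Cmod (s - z)%C <= rho / 4).
  { apply (Rmult_le_compat_l eps) in Ht; lra. }
  destruct (branch_repelling (2 + (m + (S M + n))) s z rho ltac:(lia) Hrho Hsz Hloop) as [p [Hp Hrep]].
  exists p; split; [lra | exact Hrep].
Qed.

Theorem mainTheorem15 (U : Cplx -> Prop) :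
  C_open U -> (exists z, U z) ->
  exists p, U p /\ repelling_periodic_point Cexp p.
Proof.
  intros Hopen [z0 Hz0].
  (* The return map goes through a logarithm of its target, so 0 must be avoided. *)
  assert (Hnz : exists z : C, U z /\ z <> RtoC 0).
  { destruct (classic (z0 = RtoC 0)) as [-> | H]; [| now exists z0].
    destruct (Hopen _ Hz0) as [r [Hr HU]].
    exists (RtoC (r / 2)); split.
    - apply HU; change (Cmod (RtoC (r / 2) - 0)%C < r).
      replace (RtoC (r / 2) - 0)%C with (RtoC (r / 2)) by ring.
      rewrite Cmod_R, Rabs_pos_eq; lra.
    - intros E; apply RtoC_inj in E; lra. }
  clear z0 Hz0; destruct Hnz as [z [HUz Hz]].
  assert (Hm : 0 < Cmod z) by (now apply Cmod_gt_0).
  destruct (Hopen z HUz) as [r [Hr HU]].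
  (* [Cmod z] keeps [q] away from 0; [r / 2] leaves room for the further step of length [r / 4] from
     [q] to [p]. *)
  set (r1 := Rmin (r / 2) (Cmod z)).
  assert (Hr1 : 0 < r1) by (apply Rmin_glb_lt; lra).
  assert (Hr1r : r1 <= r / 2) by apply Rmin_l.
  assert (Hr1z : r1 <= Cmod z) by apply Rmin_r.
  destruct (exists_near_eventually_real z (r1 ^ 2)) as [q [n [Hq Hreal]]]; [nra |].
  rewrite sqdist_Cmod in Hq; pose proof (Cmod_ge_0 (z - q)%C).
  assert (Hzq : Cmod (z - q)%C < r1) by nra.
  assert (Hq0 : q <> RtoC 0).
  { intros ->; replace (z - 0)%C with z in Hzq by ring; lra. }
  destruct (repelling_near_eventually_real q n (r / 4) Hq0 Hreal ltac:(lra))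
    as [p [Hp Hrep]].
  exists p; split; [| exact Hrep].
  apply HU; change (Cmod (p - z)%C < r).
  pose proof (Cmod_sub_triangle p q z); rewrite (Cmod_sub_comm q z) in *; lra.
Qed.
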